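(* Let $d\ge 2$ and let $u_1,u_2\in\mathbb{R}^d$ be unit vectors whose $d$-th coordinates are zero, $u_{1,d}=u_{2,d}=0$. Let $c=\langle u_1,u_2\rangle$, let $c_{\mathrm{two}}$ be the value of $\langle\widetilde u_1,\widetilde u_2\rangle$ after applying the two-agent intervention, and let $c_{\mathrm{one}}$ be the value of $\langle\widetilde u_1,\widetilde u_2\rangle$ after applying the one-agent intervention. Let $\rho:=c_{\mathrm{two}}-c_{\mathrm{one}}$. Then we always have $\rho\ge 0$, with exact values given by $$c_{\mathrm{two}}=1-\frac{\sqrt{2}\,(1-c)}{\sqrt{3c+5}},\qquad c_{\mathrm{one}}=\frac{c\sqrt{2}}{\sqrt{c^2+1}} .$$
   Context: Applying an intervention (a unit vector) $v\in\mathbb{R}^d$ to opinions $u_1,u_2$ gives the updated opinions $\widetilde u_i=w_i/\|w_i\|$, where $w_i=u_i+\langle u_i,v\rangle v$ for $i=1,2$ (here $\|w_i\|^2=1+3\langle u_i,v\rangle^2\ge1$); the same $v$ is applied to both opinions. $\widetilde u_{i,d}$ denotes the $d$-th coordinate of $\widetilde u_i$. The two-agent intervention is a unit vector $v$ that maximizes $\min(\widetilde u_{1,d},\widetilde u_{2,d})$ over all unit vectors. The one-agent intervention is a unit vector $v$ that maximizes $\max(\widetilde u_{1,d},\widetilde u_{2,d})$ over all unit vectors. *)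

(* Defs.v *)
From mathcomp Require Import all_boot all_order all_algebra.
From mathcomp Require Import reals.

Set Implicit Arguments.
Unset Strict Implicit.
Unset Printing Implicit Defensive.

Import Order.TTheory GRing.Theory Num.Theory.
Local Open Scope ring_scope.

Definition dot (R : realType) (d : nat) (u v : 'rV[R]_d) : R :=
  \sum_(i < d) u ord0 i * v ord0 i.

(* The Euclidean norm; MathComp-Analysis's `|u| on matrices is the sup norm. *)
Definition enorm (R : realType) (d : nat) (u : 'rV[R]_d) : R :=
  Num.sqrt (dot u u).

Definition unit_vector (R : realType) (d : nat) (u : 'rV[R]_d) : Prop :=
  enorm u = 1.

(* Coordinates are numbered from 0, so ord_max is the d-th one when the
   dimension is d = n.+1. *)
Definition last_coord (R : realType) (n : nat) (u : 'rV[R]_n.+1) : R :=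
  u ord0 ord_max.

Definition intervene (R : realType) (d : nat) (v u : 'rV[R]_d) : 'rV[R]_d :=
  let w := u + dot u v *: v in (enorm w)^-1 *: w.

Definition maximizes_over_unit_vectors (R : realType) (d : nat)
    (F : 'rV[R]_d -> R) (v : 'rV[R]_d) : Prop :=
  unit_vector v /\ forall v' : 'rV[R]_d, unit_vector v' -> F v' <= F v.

Definition two_agent_intervention (R : realType) (n : nat)
    (u1 u2 v : 'rV[R]_n.+1) : Prop :=
  maximizes_over_unit_vectors
    (fun x => Num.min (last_coord (intervene x u1))
                      (last_coord (intervene x u2))) v.

Definition one_agent_intervention (R : realType) (n : nat)
    (u1 u2 v : 'rV[R]_n.+1) : Prop :=
  maximizes_over_unit_vectors
    (fun x => Num.max (last_coord (intervene x u1))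
                      (last_coord (intervene x u2))) v.

(* Main.v *)
(* Put a_i = <u_i, v> and let z be the last coordinate of v.  The updated last
   coordinates are F_i = a_i z / sqrt (1 + 3 a_i^2), and the updated inner
   product is (c + 3 a_1 a_2) / (sqrt (1 + 3 a_1^2) sqrt (1 + 3 a_2^2)).

   One agent: as u_i is orthogonal to the last axis e, Bessel's inequality gives
   a_i^2 + z^2 <= 1, whence F_i <= 1/3, with equality only if a_i^2 = 1/3 and
   a_i^2 + z^2 = 1.  Then v = a_i u_i + z e, so the other inner product is a_i c.

   Two agents: Bessel's inequality for u_1 + u_2 gives
   (a_1 + a_2)^2 <= 2 (1 + c) (1 - z^2).  With q = sqrt ((5 + 3 c) / 2), the
   minimum of F_1 and F_2 is at most m = sqrt ((q - 1) / (3 (q + 1))), and if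
   c > -1 equality forces a_1 = a_2 and 3 a_1^2 = q - 1.  If c = -1 then
   u_2 = - u_1, and every v leaves the inner product equal to -1.

   Finally, c_one <= c_two is a one-variable inequality, which becomes
   polynomial after bounding q from above or below by an affine function of
   c. *)
Require Import Defs.
From mathcomp Require Import all_boot all_order all_algebra.
From mathcomp Require Import reals.
From mathcomp Require Import ring lra.

Set Implicit Arguments.
Unset Strict Implicit.
Unset Printing Implicit Defensive.

Import Order.TTheory GRing.Theory Num.Theory.
Local Open Scope ring_scope.

(** * Inner products and the norm of an intervened opinion *)

Section Dot.
Variables (R : realType) (d : nat).
Implicit Types (u v w : 'rV[R]_d) (a : R).

Lemma dotC u v : dot u v = dot v u.
Proof. by apply: eq_bigr => i _; rewrite mulrC. Qed.

Lemma dotDl u v w : dot (u + v) w = dot u w + dot v w.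
Proof. by rewrite -big_split; apply: eq_bigr => i _; rewrite mxE mulrDl. Qed.

Lemma dotZl a u v : dot (a *: u) v = a * dot u v.
Proof. by rewrite mulr_sumr; apply: eq_bigr => i _; rewrite mxE mulrA. Qed.

Lemma dotDr u v w : dot w (u + v) = dot w u + dot w v.
Proof. by rewrite dotC dotDl !(dotC w). Qed.

Lemma dotZr a u v : dot v (a *: u) = a * dot v u.
Proof. by rewrite dotC dotZl dotC. Qed.

Definition dotE := (dotDl, dotDr, dotZl, dotZr).

Lemma dot_ge0 u : 0 <= dot u u.
Proof. by apply: sumr_ge0 => i _; rewrite -expr2 sqr_ge0. Qed.

Lemma dot_eq0 u : dot u u = 0 -> u = 0.
Proof.
move=> /eqP; rewrite psumr_eq0 => [/allP h|i _]; last by rewrite -expr2 sqr_ge0.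
apply/rowP => i; have := h i (mem_index_enum i).
by rewrite mulf_eq0 orbb !mxE => /eqP.
Qed.

Lemma unit_vectorP u : unit_vector u <-> dot u u = 1.
Proof.
rewrite /unit_vector /enorm; split=> [h|->]; last exact: sqrtr1.
by rewrite -[LHS]sqr_sqrtr ?dot_ge0// h expr1n.
Qed.

Lemma unit_dot_le1 u v : dot u u = 1 -> dot v v = 1 -> -1 <= dot u v <= 1.
Proof.
move=> hu hv; have := dot_ge0 (u + v); have := dot_ge0 (u + -1 *: v).
by rewrite !dotE (dotC v u) hu hv; lra.
Qed.

(** Equality case of Cauchy-Schwarz: [v + u] has squared norm zero. It serves the degenerate case of
    antipodal opinions. *)
Lemma unit_dotN1 u v : dot u u = 1 -> dot v v = 1 -> dot u v = -1 -> v = - u.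
Proof.
move=> hu hv huv; have/dot_eq0/eqP : dot (v + u) (v + u) = 0.
  by rewrite !dotE (dotC v u) hu hv huv; ring.
by rewrite addr_eq0 => /eqP.
Qed.

Lemma enorm_intervened u v : dot u u = 1 -> dot v v = 1 ->
  enorm (u + dot u v *: v) = Num.sqrt (1 + 3 * dot u v ^+ 2).
Proof.
by move=> hu hv; congr Num.sqrt; rewrite !dotE (dotC v u) hu hv; ring.
Qed.

Lemma dot_intervene u1 u2 v : dot u1 u1 = 1 -> dot u2 u2 = 1 -> dot v v = 1 ->
  dot (intervene v u1) (intervene v u2) =
  (dot u1 u2 + 3 * (dot u1 v * dot u2 v)) /
    (Num.sqrt (1 + 3 * dot u1 v ^+ 2) * Num.sqrt (1 + 3 * dot u2 v ^+ 2)).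
Proof.
move=> h1 h2 hv; rewrite /intervene !enorm_intervened// !dotE hv (dotC v u2).
by rewrite invfM; ring.
Qed.

Lemma dot_intervene_self u v : dot u u = 1 -> dot v v = 1 ->
  dot (intervene v u) (intervene v u) = 1.
Proof.
move=> hu hv; have p : 0 < 1 + 3 * dot u v ^+ 2.
  by have := sqr_ge0 (dot u v); lra.
rewrite dot_intervene// hu -!expr2 sqr_sqrtr ?(ltW p)//.
by rewrite divff// gt_eqF.
Qed.

Lemma interveneN u v : intervene v (- u) = - intervene v u.
Proof.
have wN : - u + dot (- u) v *: v = - (u + dot u v *: v).
  by rewrite -scaleN1r dotZl mulN1r scaleN1r scaleNr opprD.
rewrite /intervene wN scalerN; congr (- (_^-1 *: _)); congr Num.sqrt.
by rewrite -scaleN1r dotZl dotZr mulN1r mulN1r opprK.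
Qed.

End Dot.

(** * The last axis and Bessel's inequality *)

Section LastCoordinate.
Variables (R : realType) (n : nat).
Implicit Types (u v s : 'rV[R]_n.+1).

Definition last_axis : 'rV[R]_n.+1 := delta_mx 0 ord_max.

Lemma dot_last_axis u : dot u last_axis = last_coord u.
Proof.
rewrite /dot (bigD1 ord_max)//= big1 ?addr0 => [|i ni].
  by rewrite mxE !eqxx mulr1.
by rewrite mxE (negPf ni) andbF mulr0.
Qed.

Lemma last_coord_last_axis : last_coord last_axis = 1.
Proof. by rewrite /last_coord mxE !eqxx. Qed.

Lemma last_coord_intervene u v :
  dot u u = 1 -> dot v v = 1 -> last_coord u = 0 ->
  last_coord (intervene v u) =
  dot u v * last_coord v / Num.sqrt (1 + 3 * dot u v ^+ 2).
Proof.
move=> hu hv hl; rewrite /intervene enorm_intervened// -dot_last_axis !dotE.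
by rewrite !dot_last_axis hl add0r mulrC.
Qed.

(** Here [s] is not normalised, so that the sum of the two opinions can be taken for it. *)
Lemma bessel_last_axis s v : last_coord s = 0 -> dot v v = 1 ->
  dot s v ^+ 2 <= dot s s * (1 - last_coord v ^+ 2).
Proof.
move=> hs hv.
have [s0|sn0] := eqVneq (dot s s) 0.
  rewrite (dot_eq0 s0) /dot big1 ?expr0n ?big1 ?mul0r// => i _;
  by rewrite mxE mul0r.
have sp : 0 < dot s s by rewrite lt_def sn0 dot_ge0.
(* [r] is [v] minus its projections on the orthogonal vectors [s] and [last_axis]; its squared norm
   times [dot s s] is the gap in the inequality. *)
set r := v + (- (dot s v / dot s s)) *: s + (- last_coord v) *: last_axis.
have : 0 <= dot s s * dot r r by rewrite mulr_ge0 ?dot_ge0.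
have -> : dot s s * dot r r = dot s s * (1 - last_coord v ^+ 2) - dot s v ^+ 2.
  rewrite !dotE !(dotC last_axis) !dot_last_axis hs hv (dotC v s).
  by rewrite last_coord_last_axis; field.
by rewrite subr_ge0.
Qed.

(** The difference of the two sides has squared norm [1 - dot u v ^+ 2 - last_coord v ^+ 2]. *)
Lemma bessel_last_axis_eq u v : dot u u = 1 -> last_coord u = 0 -> dot v v = 1 ->
  dot u v ^+ 2 + last_coord v ^+ 2 = 1 ->
  v = dot u v *: u + last_coord v *: last_axis.
Proof.
move=> hu hl hv h; apply/eqP; rewrite -subr_eq0; apply/eqP/dot_eq0.
rewrite -scaleN1r !dotE !(dotC last_axis) !dot_last_axis hl hu hv.
by rewrite last_coord_last_axis (dotC v u); lra.
Qed.

End LastCoordinate.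

(** * Real inequalities behind the optimal values *)

Section Scalar.
Variable R : realType.
Implicit Types a z c k q m : R.

(** After squaring, [z ^+ 2 <= 1 - a ^+ 2] makes the gap at least [(3 * a ^+ 2 - 1) ^+ 2 / 9]. *)
Lemma one_agent_bound a z : a ^+ 2 <= 1 - z ^+ 2 ->
  a * z / Num.sqrt (1 + 3 * a ^+ 2) <= 3^-1.
Proof.
move=> h; have p : 0 < 1 + 3 * a ^+ 2 by have := sqr_ge0 a; lra.
have sp : 0 < Num.sqrt (1 + 3 * a ^+ 2) by rewrite sqrtr_gt0.
rewrite ler_pdivrMr//; have [n|p'] := lerP (a * z) 0.
  by apply: (le_trans n); rewrite mulr_ge0 ?invr_ge0 ?ler0n ?ltW.
rewrite -ler_sqr ?nnegrE ?(ltW p') ?mulr_ge0 ?invr_ge0 ?ler0n ?(ltW sp)//.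
rewrite [leRHS]exprMn sqr_sqrtr ?(ltW p)// exprMn.
have : a ^+ 2 * z ^+ 2 <= a ^+ 2 * (1 - a ^+ 2).
  by rewrite ler_wpM2l ?sqr_ge0//; lra.
have := sqr_ge0 (3 * a ^+ 2 - 1); lra.
Qed.

Lemma one_agent_bound_eq a z : a ^+ 2 <= 1 - z ^+ 2 ->
  3^-1 <= a * z / Num.sqrt (1 + 3 * a ^+ 2) ->
  a ^+ 2 = 3^-1 /\ z ^+ 2 = 2 / 3.
Proof.
move=> h; have p : 0 < 1 + 3 * a ^+ 2 by have := sqr_ge0 a; lra.
have sp : 0 < Num.sqrt (1 + 3 * a ^+ 2) by rewrite sqrtr_gt0.
rewrite ler_pdivlMr// => hM.
have := hM; rewrite -ler_sqr ?nnegrE ?(le_trans _ hM)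
  ?mulr_ge0 ?invr_ge0 ?ler0n ?(ltW sp)//.
rewrite [leLHS]exprMn sqr_sqrtr ?(ltW p)// exprMn => {hM} hM.
have h2 : a ^+ 2 * z ^+ 2 <= a ^+ 2 * (1 - a ^+ 2).
  by rewrite ler_wpM2l ?sqr_ge0//; lra.
have : (3 * a ^+ 2 - 1) ^+ 2 = 0.
  by apply/eqP; rewrite eq_le sqr_ge0 andbT; lra.
move/eqP; rewrite sqrf_eq0 subr_eq0 => /eqP ha.
have a3 : a ^+ 2 = 3^-1 by lra.
by split=> //; move: h hM; rewrite a3; lra.
Qed.

(* With [t = a1 ^+ 2] and [T = (q - 1) / 3], [k * m ^+ 2] is [T ^+ 2], and the
   hypotheses collapse to [- (t - T) ^+ 2 >= 0]. *)
Lemma two_agent_bound_aux a1 a2 z k q m : 0 < k -> 1 < q -> q ^+ 2 = 1 + 3 * k ->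
  3 * (q + 1) * m ^+ 2 = q - 1 ->
  (a1 + a2) ^+ 2 <= 4 * k * (1 - z ^+ 2) ->
  0 < a1 * a2 -> a1 ^+ 2 <= a2 ^+ 2 ->
  m ^+ 2 * (1 + 3 * a1 ^+ 2) <= a1 ^+ 2 * z ^+ 2 ->
  [/\ a1 = a2, 3 * a1 ^+ 2 = q - 1 & a1 ^+ 2 * z ^+ 2 <= m ^+ 2 * q].
Proof.
move=> k0 q1 hq hm hB a12 a1a2 hF.
have a1p : 0 < a1 ^+ 2.
  by rewrite exprn_even_gt0//=; apply: contraTneq a12 => ->; rewrite mul0r ltxx.
(* [a1] and [a2] have the same sign, and [a1] is the smaller in absolute value. *)
have ha : a1 ^+ 2 <= a1 * a2.
  rewrite -ler_sqr ?nnegrE ?sqr_ge0 ?(ltW a12)// (exprMn _ a1 a2) (expr2 (a1 ^+ 2)).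
  by rewrite ler_wpM2l ?sqr_ge0.
have km : 9 * (k * m ^+ 2) = (q - 1) ^+ 2.
  have -> : k = (q ^+ 2 - 1) / 3 by lra.
  by transitivity ((q - 1) * (3 * (q + 1) * m ^+ 2)); [field | rewrite hm; ring].
have hs : 4 * a1 ^+ 2 <= (a1 + a2) ^+ 2.
  have -> : (a1 + a2) ^+ 2 = a1 ^+ 2 + 2 * (a1 * a2) + a2 ^+ 2 by ring.
  by lra.
(* This is [hF] times [4 * k], with [z] eliminated by [hB]. *)
have h1 : 4 * (k * m ^+ 2) * (1 + 3 * a1 ^+ 2) <= a1 ^+ 2 * (4 * k - (a1 + a2) ^+ 2).
  have : 4 * k * (m ^+ 2 * (1 + 3 * a1 ^+ 2)) <= 4 * k * (a1 ^+ 2 * z ^+ 2).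
    by rewrite ler_wpM2l// mulr_ge0// ltW.
  have : a1 ^+ 2 * (a1 + a2) ^+ 2 <= a1 ^+ 2 * (4 * k * (1 - z ^+ 2)).
    by rewrite ler_wpM2l ?sqr_ge0.
  by lra.
have h2 : a1 ^+ 2 * (4 * a1 ^+ 2) <= a1 ^+ 2 * (a1 + a2) ^+ 2.
  by rewrite ler_wpM2l ?sqr_ge0.
have kE : k = (q ^+ 2 - 1) / 3 by lra.
have kmE : k * m ^+ 2 = (q - 1) ^+ 2 / 9 by lra.
have hT : 3 * a1 ^+ 2 = q - 1.
  apply/eqP; rewrite -subr_eq0 -sqrf_eq0 eq_le sqr_ge0 andbT.
  by move: h1; rewrite kmE kE; lra.
have hs' : (a1 + a2) ^+ 2 <= 4 * a1 ^+ 2.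
  rewrite -(ler_pM2l a1p).
  have a1E : a1 ^+ 2 = (q - 1) / 3 by lra.
  by move: h1; rewrite kmE kE !a1E; lra.
have hz : k * (a1 ^+ 2 * z ^+ 2) <= k * (m ^+ 2 * q).
  have : a1 ^+ 2 * (4 * a1 ^+ 2) <= a1 ^+ 2 * (4 * k * (1 - z ^+ 2)).
    by rewrite ler_wpM2l ?sqr_ge0 ?(le_trans hs).
  have : k * (m ^+ 2 * q) = a1 ^+ 2 * (k - a1 ^+ 2).
    have -> : a1 ^+ 2 = (q - 1) / 3 by lra.
    by rewrite mulrA kmE kE; field.
  by lra.
split=> //; last by rewrite ler_pM2l in hz.
(* By [hs'], [(a1 - a2) ^+ 2] is at most [4 * a1 ^+ 2 - 4 * (a1 * a2)], which [ha] makes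
   nonpositive. *)
apply/eqP; rewrite -subr_eq0 -sqrf_eq0 eq_le sqr_ge0 andbT.
have -> : (a1 - a2) ^+ 2 = a1 ^+ 2 - 2 * (a1 * a2) + a2 ^+ 2 by ring.
move: hs'; have -> : (a1 + a2) ^+ 2 = a1 ^+ 2 + 2 * (a1 * a2) + a2 ^+ 2 by ring.
by lra.
Qed.

(** [q] and [p] are the denominators of the two closed forms, each divided by the square root of 2.
    Clearing them and squaring removes [p]; the signs of the two sides dictate the case split on
    [c]. *)
Lemma rho_ge0 c q p : -1 <= c <= 1 -> 0 < q -> 0 < p ->
  q ^+ 2 = (5 + 3 * c) / 2 -> p ^+ 2 = (1 + c ^+ 2) / 2 ->
  c / p <= 1 - (1 - c) / q.
Proof.
move=> /andP[c1 c2] q0 p0 hq hp.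
suff h : c * q <= p * (q - (1 - c)).
  rewrite -subr_ge0.
  have -> : 1 - (1 - c) / q - c / p = (p * (q - (1 - c)) - c * q) / (p * q).
    by field; rewrite !gt_eqF.
  by rewrite divr_ge0 ?subr_ge0// mulr_ge0 ?ltW.
(* The chord and the tangent at [c = 1] of [q], a concave function of [c]. *)
have qlb : (3 + c) / 2 <= q.
  rewrite -ler_sqr ?nnegrE ?(ltW q0) ?hq//; last lra.
  suff : 0 <= (1 - c) * (1 + c) by lra.
  by apply: mulr_ge0; lra.
have qub : q <= (13 + 3 * c) / 8.
  by have := sqr_ge0 (q - 2); rewrite sqrrB hq; lra.
have key : (p * (q - (1 - c))) ^+ 2 - (c * q) ^+ 2 =
   (1 - c) * ((7 + 6 * c + 5 * c ^+ 2 - 2 * c ^+ 3) / 4 - (1 + c ^+ 2) * q).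
  by rewrite (exprMn 2 p) (exprMn 2 c) hp sqrrB hq; field.
have d0 : 0 <= 1 - c by lra.
have s0 : 0 <= 1 + c ^+ 2 by have := sqr_ge0 c; lra.
have [c0|c0] := lerP 0 c.
  rewrite -ler_sqr ?nnegrE ?(mulr_ge0 c0 (ltW q0))//; last first.
    by rewrite mulr_ge0 ?(ltW p0)//; lra.
  rewrite -subr_ge0 key mulr_ge0//.
  have : (1 + c ^+ 2) * q <= (1 + c ^+ 2) * ((13 + 3 * c) / 8) by rewrite ler_wpM2l.
  suff : 0 <= (1 - c) * (1 + 10 * c + 7 * c ^+ 2) by lra.
  by rewrite mulr_ge0//; have := sqr_ge0 c; lra.
have cq : 0 <= - (c * q) by rewrite -mulNr mulr_ge0 ?ltW// oppr_gt0.
(* With the chord bound, the second factor in [key] is at most [(1 - c ^+ 2) * (4 * c + 1) / 4],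
   whence the threshold. Above it [q - (1 - c)] is positive, so the sides have opposite signs. *)
have [c4|c4] := lerP (- 4^-1) c.
  have : 0 <= p * (q - (1 - c)) by rewrite mulr_ge0 ?(ltW p0)//; lra.
  by lra.
(* Since [c * q] is negative, the squares must now compare the other way. *)
suff : `|p * (q - (1 - c))| <= `|c * q|.
  by rewrite (ler0_norm (_ : c * q <= 0)) ?ler_norml ?opprK; [case/andP|lra].
rewrite -ler_sqr ?nnegrE ?normr_ge0// !real_normK ?num_real//.
rewrite -subr_le0 key -oppr_ge0 -mulrN mulr_ge0//.
have : (1 + c ^+ 2) * ((3 + c) / 2) <= (1 + c ^+ 2) * q by rewrite ler_wpM2l.
suff : 0 <= (1 - c) * (1 + c) * (- (4 * c + 1)) by lra.
by rewrite !mulr_ge0//; lra.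
Qed.

(** [4 * k] stands for the squared norm of [u1 + u2]. As [m] is positive, [a1] and [a2] both have
    the sign of [z]; by symmetry the one with the smaller square can come first. *)
Lemma two_agent_bound a1 a2 z k q m : 0 < k -> 1 < q -> q ^+ 2 = 1 + 3 * k ->
  0 < m -> 3 * (q + 1) * m ^+ 2 = q - 1 ->
  (a1 + a2) ^+ 2 <= 4 * k * (1 - z ^+ 2) ->
  m <= a1 * z / Num.sqrt (1 + 3 * a1 ^+ 2) ->
  m <= a2 * z / Num.sqrt (1 + 3 * a2 ^+ 2) ->
  [/\ a1 = a2, 3 * a1 ^+ 2 = q - 1 &
      a1 * z / Num.sqrt (1 + 3 * a1 ^+ 2) <= m].
Proof.
move=> k0 q1 hq m0 hm hB h1 h2.
have pos a : 0 < 1 + 3 * a ^+ 2 by have := sqr_ge0 a; lra.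
have spos a : 0 < Num.sqrt (1 + 3 * a ^+ 2) by rewrite sqrtr_gt0.
have sqr a : m <= a * z / Num.sqrt (1 + 3 * a ^+ 2) ->
    0 < a * z /\ m ^+ 2 * (1 + 3 * a ^+ 2) <= a ^+ 2 * z ^+ 2.
  rewrite ler_pdivlMr// => h.
  have mp : 0 < m * Num.sqrt (1 + 3 * a ^+ 2) by rewrite mulr_gt0.
  have ap := lt_le_trans mp h.
  split=> //; move: h; rewrite -ler_sqr ?nnegrE ?(ltW mp) ?(ltW ap)//.
  by rewrite (exprMn _ m) (exprMn _ a) sqr_sqrtr ?(ltW (pos a)).
have [a1z h1'] := sqr _ h1; have [a2z h2'] := sqr _ h2.
have a12 : 0 < a1 * a2.
  have z0 : 0 < z ^+ 2.
    by rewrite exprn_even_gt0//=; apply: contraTneq a1z => ->; rewrite mulr0 ltxx.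
  rewrite -(pmulr_lgt0 _ z0).
  have -> : a1 * a2 * z ^+ 2 = (a1 * z) * (a2 * z) by ring.
  exact: mulr_gt0.
have [e12 hT hz] : [/\ a1 = a2, 3 * a1 ^+ 2 = q - 1 &
    a1 ^+ 2 * z ^+ 2 <= m ^+ 2 * q].
  have [le12|/ltW le21] := lerP (a1 ^+ 2) (a2 ^+ 2).
    exact: (two_agent_bound_aux k0).
  rewrite addrC in hB; rewrite mulrC in a12.
  by have [-> ? ?] := two_agent_bound_aux k0 q1 hq hm hB a12 le21 h2'.
split=> //; rewrite ler_pdivrMr// hT.
rewrite -ler_sqr ?nnegrE ?(ltW a1z) ?mulr_ge0 ?sqrtr_ge0 ?(ltW m0)//.
rewrite (exprMn _ m) (exprMn _ a1) sqr_sqrtr; last by lra.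
by rewrite addrC subrK.
Qed.

End Scalar.

(** * The one-agent optimum *)

Section OneAgent.
Variables (R : realType) (n : nat).
Implicit Types (u v : 'rV[R]_n.+1).

Lemma last_coord_intervene_le u v :
  dot u u = 1 -> last_coord u = 0 -> dot v v = 1 ->
  last_coord (intervene v u) <= 3^-1.
Proof.
move=> hu hl hv; rewrite last_coord_intervene//; apply: one_agent_bound.
by have := bessel_last_axis hl hv; rewrite hu mul1r.
Qed.

Lemma last_coord_intervene_attained u : dot u u = 1 -> last_coord u = 0 ->
  exists2 v, dot v v = 1 & last_coord (intervene v u) = 3^-1.
Proof.
(* The equality case of [one_agent_bound] dictates the squared coefficients [1 / 3] and [2 / 3]. *)
move=> hu hl; set a : R := Num.sqrt 3^-1.
have a2 : a ^+ 2 = 3^-1 by rewrite sqr_sqrtr// invr_ge0 ler0n.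
have s2 : Num.sqrt (2 : R) ^+ 2 = 2 by rewrite sqr_sqrtr// ler0n.
have s0 : Num.sqrt (2 : R) != 0 by rewrite gt_eqF// sqrtr_gt0 ltr0n.
pose v := a *: u + (Num.sqrt 2 * a) *: last_axis R n.
have uv : dot u v = a by rewrite !dotE dot_last_axis hu hl mulr1 mulr0 addr0.
have lv : last_coord v = Num.sqrt 2 * a.
  by rewrite -dot_last_axis !dotE !dot_last_axis hl last_coord_last_axis; ring.
have vv : dot v v = 1.
  rewrite !dotE !(dotC (last_axis R n)) !dot_last_axis hu hl last_coord_last_axis.
  transitivity (a ^+ 2 + Num.sqrt 2 ^+ 2 * a ^+ 2); first by ring.
  by rewrite a2 s2; lra.
exists v => //; rewrite last_coord_intervene// uv lv a2.
have -> : 1 + 3 * 3^-1 = 2 :> R by lra.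
by rewrite -a2; field.
Qed.

(** [u] is the opinion that reaches the maximum. The sign of [dot u v] remains unknown, but only its
    square enters the result. *)
Lemma one_agent_correlation u u' v :
  dot u u = 1 -> dot u' u' = 1 -> dot v v = 1 ->
  last_coord u = 0 -> last_coord u' = 0 ->
  3^-1 <= last_coord (intervene v u) ->
  dot (intervene v u) (intervene v u') =
  dot u u' * Num.sqrt 2 / Num.sqrt (dot u u' ^+ 2 + 1).
Proof.
move=> hu hu' hv hl hl'; rewrite last_coord_intervene// => h.
have hB : dot u v ^+ 2 <= 1 - last_coord v ^+ 2.
  by have := bessel_last_axis hl hv; rewrite hu mul1r.
have [a2 z2] := one_agent_bound_eq hB h.
have vE : v = dot u v *: u + last_coord v *: last_axis R n.
  by apply: bessel_last_axis_eq => //; rewrite a2 z2; lra.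
have u'v : dot u' v = dot u v * dot u u'.
  by rewrite [in LHS]vE !dotE dot_last_axis hl' mulr0 addr0 (dotC u').
rewrite dot_intervene// u'v.
have -> : dot u v * (dot u v * dot u u') = dot u v ^+ 2 * dot u u' by ring.
rewrite (exprMn _ (dot u v)) a2; set c := dot u u'.
have -> : 1 + 3 * 3^-1 = 2 :> R by lra.
have -> : 1 + 3 * (3^-1 * c ^+ 2) = c ^+ 2 + 1 by field.
have -> : c + 3 * (3^-1 * c) = c * Num.sqrt 2 ^+ 2.
  by rewrite sqr_sqrtr ?ler0n//; field.
have c0 : Num.sqrt (c ^+ 2 + 1) != 0.
  by rewrite gt_eqF// sqrtr_gt0; have := sqr_ge0 c; lra.
by field; rewrite c0 gt_eqF// sqrtr_gt0 ltr0n.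
Qed.

End OneAgent.

(** * The two-agent optimum, for opinions that are not antipodal *)

Section TwoAgent.
Variables (R : realType) (n : nat) (u1 u2 : 'rV[R]_n.+1).
Hypotheses (h1 : dot u1 u1 = 1) (h2 : dot u2 u2 = 1).
Hypotheses (l1 : last_coord u1 = 0) (l2 : last_coord u2 = 0).
Implicit Type v : 'rV[R]_n.+1.

Let c := dot u1 u2.
(** At the optimum, [q] is the common squared norm of the two opinions before normalisation, and [m]
    their common last coordinate after it. *)
Let q := Num.sqrt ((5 + 3 * c) / 2).
Let m := Num.sqrt ((q - 1) / (3 * (q + 1))).

Hypothesis c_gtN1 : -1 < c.

Let q2 : q ^+ 2 = (5 + 3 * c) / 2.
Proof. by rewrite sqr_sqrtr//; move: c_gtN1; lra. Qed.

Let q_gt1 : 1 < q.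
Proof.
rewrite -ltr_sqr ?nnegrE ?ler01 ?sqrtr_ge0// q2 expr1n.
by move: c_gtN1; lra.
Qed.

Let m_gt0 : 0 < m.
Proof. by rewrite sqrtr_gt0 divr_gt0//; move: q_gt1; lra. Qed.

Let m2 : 3 * (q + 1) * m ^+ 2 = q - 1.
Proof.
rewrite sqr_sqrtr; first by field; move: q_gt1 => ?; apply/eqP; lra.
by rewrite divr_ge0//; move: q_gt1; lra.
Qed.

Lemma two_agent_attained : exists2 v, dot v v = 1 &
  last_coord (intervene v u1) = m /\ last_coord (intervene v u2) = m.
Proof.
have qp : 0 < q + 1 by move: q_gt1; lra.
have sq0 : Num.sqrt q != 0 by rewrite gt_eqF// sqrtr_gt0; move: q_gt1; lra.
have sp0 : Num.sqrt (q + 1) != 0 by rewrite gt_eqF// sqrtr_gt0.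
pose a := m * Num.sqrt (q + 1); pose z := Num.sqrt q / Num.sqrt (q + 1).
have a2 : 3 * a ^+ 2 = q - 1.
  by rewrite -m2 (exprMn _ m) (sqr_sqrtr (ltW qp)); ring.
have z2 : z ^+ 2 = q / (q + 1).
  by rewrite expr_div_n !sqr_sqrtr ?(ltW qp)//; move: q_gt1; lra.
have c0 : 1 + c != 0 by rewrite gt_eqF//; move: c_gtN1; lra.
(* Each opinion has inner product [1 + c] with [u1 + u2], so this coefficient makes both inner
   products with [v] equal to [a]. *)
pose v := (a / (1 + c)) *: (u1 + u2) + z *: last_axis R n.
have dv x : dot x v = a / (1 + c) * (dot x u1 + dot x u2) + z * last_coord x.
  by rewrite dotDr !dotZr dotDr dot_last_axis.
have lv : last_coord v = z.
  by rewrite -dot_last_axis !dotE !dot_last_axis l1 l2 last_coord_last_axis; ring.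
have v1 : dot u1 v = a by rewrite dv h1 l1 -/c; field.
have v2 : dot u2 v = a by rewrite dv (dotC u2 u1) h2 l2 -/c; field.
have vv : dot v v = 1.
  rewrite dv !(dotC v) v1 v2 lv.
  (* As [1 + c = 2 * (q ^+ 2 - 1) / 3], the terms are [1 / (q + 1)] and [q / (q + 1)]. *)
  transitivity (2 * a ^+ 2 / (1 + c) + z ^+ 2); first by ring.
  have -> : a ^+ 2 = (q - 1) / 3 by lra.
  have -> : c = 2 * (q ^+ 2 - 1) / 3 - 1 by rewrite q2; field.
  rewrite z2; field; move: q_gt1 => q1.
  apply/andP; split; first by rewrite gt_eqF.
  by apply/eqP; nra.
exists v => //; rewrite !last_coord_intervene// v1 v2 lv a2.
have -> : 1 + (q - 1) = q by ring.
by split; rewrite /a /z; field; apply/andP.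
Qed.

(** Used twice: the first conclusion shows that no [v] brings both coordinates above [m], the second
    gives the correlation at every optimum. *)
Lemma two_agent_optimal v : dot v v = 1 ->
  m <= last_coord (intervene v u1) -> m <= last_coord (intervene v u2) ->
  last_coord (intervene v u1) <= m /\
  dot (intervene v u1) (intervene v u2) = 1 - (1 - c) / q.
Proof.
move=> hv; rewrite !last_coord_intervene// => b1 b2.
have hB : (dot u1 v + dot u2 v) ^+ 2 <=
    4 * ((1 + c) / 2) * (1 - last_coord v ^+ 2).
  have ls : last_coord (u1 + u2) = 0.
    by rewrite -dot_last_axis dotDl !dot_last_axis l1 l2 addr0.
  have := bessel_last_axis ls hv; rewrite !dotE (dotC u2 u1) h1 h2 -/c.
  by lra.
have k0 : 0 < (1 + c) / 2 by move: c_gtN1; lra.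
have hq : q ^+ 2 = 1 + 3 * ((1 + c) / 2) by rewrite q2; field.
have [e12 hT hM] := two_agent_bound k0 q_gt1 hq m_gt0 m2 hB b1 b2.
split=> //; rewrite dot_intervene// -e12 -expr2 -expr2 hT.
have -> : 1 + (q - 1) = q by ring.
rewrite sqr_sqrtr; last by move: q_gt1; lra.
by rewrite -/c; field; rewrite gt_eqF//; move: q_gt1; lra.
Qed.

End TwoAgent.

(* The dimension is d = n.+2, i.e. an arbitrary d >= 2. *)
Theorem proposition5p1 (R : realType) (n : nat) (u1 u2 : 'rV[R]_n.+2)
    (hu1 : unit_vector u1) (hu2 : unit_vector u2)
    (hd1 : last_coord u1 = 0) (hd2 : last_coord u2 = 0) :
  let c := dot u1 u2 in
  (exists v, two_agent_intervention u1 u2 v) /\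
  (exists v, one_agent_intervention u1 u2 v) /\
  (forall v_two v_one : 'rV[R]_n.+2,
    two_agent_intervention u1 u2 v_two ->
    one_agent_intervention u1 u2 v_one ->
    let c_two := dot (intervene v_two u1) (intervene v_two u2) in
    let c_one := dot (intervene v_one u1) (intervene v_one u2) in
    let rho := c_two - c_one in
    0 <= rho /\
    c_two = 1 - Num.sqrt 2 * (1 - c) / Num.sqrt (3 * c + 5) /\
    c_one = c * Num.sqrt 2 / Num.sqrt (c ^+ 2 + 1)).
Proof.
move=> c; have /unit_vectorP h1 := hu1; have /unit_vectorP h2 := hu2.
have cb : -1 <= c <= 1 by exact: unit_dot_le1.
have /andP[cl cr] := cb.
set q := Num.sqrt ((5 + 3 * c) / 2).
have s2 : 0 < Num.sqrt (2 : R) by rewrite sqrtr_gt0 ltr0n.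
have two : (exists v, two_agent_intervention u1 u2 v) /\
    forall v, two_agent_intervention u1 u2 v ->
    dot (intervene v u1) (intervene v u2) = 1 - (1 - c) / q.
  have [cN1|cn] := eqVneq c (-1).
    have u2E := unit_dotN1 h1 h2 cN1.
    have minN (x : R) : Num.min x (- x) <= 0.
      by rewrite ge_min; case: (lerP x 0) => //= ?; rewrite oppr_le0 ltW.
    have lastN v : last_coord (intervene v u2) = - last_coord (intervene v u1).
      by rewrite u2E interveneN /last_coord mxE.
    split.
      (* The two last coordinates are opposite, so their minimum is at most 0; [u1] reaches 0
         because its own last coordinate vanishes. *)
      exists u1; split=> // v _; rewrite !lastN (last_coord_intervene h1 h1 hd1).
      by rewrite hd1 mulr0 mul0r oppr0 minxx.
    move=> v [/unit_vectorP hv _].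
    rewrite u2E interveneN -scaleN1r dotZr dot_intervene_self// /q cN1.
    have -> : (5 + 3 * -1) / 2 = 1 :> R by lra.
    by rewrite sqrtr1; lra.
  have c_gt : -1 < c by rewrite lt_def cn cl.
  have [v0 hv0 [v01 v02]] := two_agent_attained h1 h2 hd1 hd2 c_gt.
  split.
    exists v0; split=> [|v /unit_vectorP hv]; first exact/unit_vectorP.
    rewrite v01 v02 minxx leNgt; apply/negP; rewrite lt_min => /andP[m1 m2].
    have [] := two_agent_optimal h1 h2 hd1 hd2 c_gt hv (ltW m1) (ltW m2).
    by rewrite leNgt m1.
  move=> v [/unit_vectorP hv /(_ v0)].
  rewrite v01 v02 minxx le_min => /(_ (proj2 (unit_vectorP _) hv0)) /andP[m1 m2].
  by have [] := two_agent_optimal h1 h2 hd1 hd2 c_gt hv m1 m2.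
have [two_ex two_val] := two.
have [v1 hv1 v1E] := last_coord_intervene_attained h1 hd1.
split=> //; split.
  exists v1; split=> [|v /unit_vectorP hv]; first exact/unit_vectorP.
  by rewrite le_max v1E ge_max !last_coord_intervene_le.
move=> v w /two_val -> [/unit_vectorP hw /(_ v1 (proj2 (unit_vectorP _) hv1))].
rewrite v1E => hmax /=.
have -> : dot (intervene w u1) (intervene w u2) =
    c * Num.sqrt 2 / Num.sqrt (c ^+ 2 + 1).
  (* Since [v1] reaches the bound [1 / 3] for [u1], an optimal [w] reaches it for [u1] or for [u2];
     both cases agree because the correlation is symmetric. *)
  have : 3^-1 <= Num.max (last_coord (intervene w u1))
                         (last_coord (intervene w u2)).
    by apply: (le_trans _ hmax); rewrite le_max lexx.
  rewrite le_max => /orP[] hF; first exact: one_agent_correlation.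
  by rewrite dotC [c]dotC; apply: one_agent_correlation.
(* A factor [Num.sqrt 2] is taken out of both denominators to reach the form of [rho_ge0]. *)
have qE : Num.sqrt (3 * c + 5) = Num.sqrt 2 * q.
  by rewrite -sqrtrM ?ler0n//; congr Num.sqrt; field.
have pE : Num.sqrt (c ^+ 2 + 1) = Num.sqrt 2 * Num.sqrt ((1 + c ^+ 2) / 2).
  by rewrite -sqrtrM ?ler0n//; congr Num.sqrt; field.
have p2 : 0 < (1 + c ^+ 2) / 2 by have := sqr_ge0 c; lra.
have q0 : 0 < q by rewrite sqrtr_gt0; lra.
rewrite qE pE; set p := Num.sqrt ((1 + c ^+ 2) / 2).
have p0 : 0 < p by rewrite sqrtr_gt0.
have -> : c * Num.sqrt 2 / (Num.sqrt 2 * p) = c / p by field; rewrite !gt_eqF.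
have -> : Num.sqrt 2 * (1 - c) / (Num.sqrt 2 * q) = (1 - c) / q.
  by field; rewrite !gt_eqF.
split=> //; rewrite subr_ge0; apply: rho_ge0 => //; rewrite sqr_sqrtr//.
  by lra.
exact: ltW.
Qed.
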